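(* For all integers $n,m\geq 0$ and any indeterminate $\lambda$, \[ \sum_{k=0}^{n}\binom{k+\lambda-1}{k}A_{n+m,m+k}(\mathbf{t}) = \sum_{k=0}^{n}\binom{n+\lambda}{k}\binom{n+\lambda-k-1}{n-k}A_{m+k,m}(\mathbf{t})\,t_1^{n-k}, \] and \[ \sum_{k=0}^{n}\binom{k+\lambda-1}{k}A_{n+m,m+k}(\mathbf{t}) = \sum_{k=0}^{n}(-1)^{n-k}\binom{n+\lambda}{k}\mathcal{Y}_{m+k}(\mathbf{t})\,t_1^{n-k+1}. \]
   Context: $t_1,t_2,\dots$ are indeterminates. For a set partition $\pi$ assign each block of size $j$ the weight $t_j$, and let $w(\pi)$ be the product of its block weights. $\mathcal{Y}_n(\mathbf{t})$ is the sum of $w(\pi)$ over all partitions $\pi$ of $[n]=\{1,\dots,n\}$ ($\mathcal{Y}_0=1$; the complete Bell polynomial). For $0\le k\le n$, $A_{n,k}(\mathbf{t})$ is the sum of $w(\pi)$ over all partitions of $[n+1]$ whose largest singleton block is $\{k+1\}$ (i.e. $\{k+1\}$ is a block and no $\{i\}$ with $i>k+1$ is a block). Binomial coefficients with the indeterminate $\lambda$ are polynomials in $\lambda$: $\binom{a}{k}=a(a-1)\cdots(a-k+1)/k!$. *)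

(* Defs.v *)
From mathcomp Require Import all_boot all_order all_algebra.
From mathcomp Require Import monalg.

Set Implicit Arguments.
Unset Strict Implicit.
Unset Printing Implicit Defensive.

Import GRing.Theory.
Local Open Scope ring_scope.

(* The ground set [n] = {1, ..., n} is encoded by 'I_n, with i : 'I_n standing
   for the integer i + 1; hence the block {k+1} is the singleton of the ordinal
   of value k. *)

Definition pweight (R : comNzRingType) (t : nat -> R) (n : nat)
    (P : {set {set 'I_n}}) : R :=
  \prod_(B in P) t #|B|.

Definition bell (R : comNzRingType) (t : nat -> R) (n : nat) : R :=
  \sum_(P : {set {set 'I_n}} | partition P [set: 'I_n]) pweight t P.

Definition largest_singleton (n : nat) (P : {set {set 'I_n}}) (k : nat) : bool :=
  [exists i : 'I_n, [&& i == k :> nat, [set i] \in P &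
                        [forall j : 'I_n, (i < j)%N ==> ([set j] \notin P)]]].

Definition bellA (R : comNzRingType) (t : nat -> R) (n k : nat) : R :=
  \sum_(P : {set {set 'I_n.+1}} |
          partition P [set: 'I_n.+1] && largest_singleton P k) pweight t P.

(* a (a - 1) ... (a - k + 1) / k! *)
Definition polybin (a : {poly rat}) (k : nat) : {poly rat} :=
  (k`!%:R)^-1 *: \prod_(i < k) (a - i%:R).

Definition lambda : {poly rat} := 'X.

(* QQ[lambda][t_0, t_1, t_2, ...]; blocks are nonempty, so t_0 never occurs in
   the weight of a partition. *)
Notation tring := {malg {poly rat}[{cmonom nat}]}.

Definition tvar (j : nat) : tring := << ucm j >>.

(* Main.v *)
(* Splitting off a singleton {x} shows that the weighted number of partitions of
   a d-set D with no singleton in an e-subset E satisfies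
   a(D, E + x) = a(D, E) - t_1 a(D - x, E).  Umbrally, with L = umbral t the functional
   sending x^i to Y_i, it is therefore L(x^(d - e) (x - t_1)^e), so that
   A_(n,k) = t_1 L(x^k (x - t_1)^(n - k)).  Both claims are the images under
   p |-> t_1 L(x^m p) of polynomial identities, and these hold because all three
   sides obey u_(n+1) = (x - t_1) u_n + 'C(n + lambda, n + 1) x^(n+1). *)
From HB Require Import structures.
Require Import Defs.
From mathcomp Require Import all_boot all_order all_algebra.
From mathcomp Require Import monalg ring.

Set Implicit Arguments.
Unset Strict Implicit.
Unset Printing Implicit Defensive.

Import GRing.Theory Num.Theory.
Local Open Scope ring_scope.

(** * Weighted partitions without singletons in a prescribed subset *)

Definition singleton_free {T : finType} (E : {set T}) (P : {set {set T}}) : bool :=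
  [forall x in E, [set x] \notin P].

(** An arbitrary [D] inside a fixed [T] allows points to be deleted without relabelling. *)
Definition partition_sum {R : comNzRingType} (t : nat -> R) {T : finType}
    (D E : {set T}) : R :=
  \sum_(P | partition P D && singleton_free E P) \prod_(B in P) t #|B|.

Lemma singleton_freeU1 (T : finType) (x : T) (E : {set T}) P :
  singleton_free (x |: E) P = ([set x] \notin P) && singleton_free E P.
Proof.
apply/forall_inP/andP => [xEP | [xP /forall_inP EP] y].
  split; first by apply: xEP; rewrite setU11.
  by apply/forall_inP=> y Ey; apply: xEP; rewrite setU1r.
by case/setU1P => [-> //|]; apply: EP.
Qed.

(** Deleting the block {x} is a bijection onto the partitions of [D :\ x]. Its inverse adds {x},
    which creates no singleton in [E] because x lies outside [E]. *)
Lemma sum_partition_singleton (R : comNzRingType) (t : nat -> R) (T : finType)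
    (D E : {set T}) (x : T) :
  x \in D -> x \notin E ->
  \sum_(P | [&& partition P D, singleton_free E P & [set x] \in P])
     \prod_(B in P) t #|B|
  = t 1%N * partition_sum t (D :\ x) E.
Proof.
move=> Dx E'x; rewrite /partition_sum big_distrr /=.
have notin P : partition P (D :\ x) -> [set x] \notin P.
  move=> partP; apply/negP => /(partitionS partP).
  by rewrite sub1set !inE eqxx.
rewrite (reindex_onto (fun P => [set x] |: P) (fun P => P :\ [set x])); last first.
  by move=> P /and3P[_ _ xP]; rewrite setD1K.
apply: eq_big => [P | P /andP[/and3P[partP EP _] /eqP defP]].
  rewrite setU11 andbT; apply/andP/andP => [[/andP[partP EP] /eqP defP] | [partP EP]].
    have xP := setU11 [set x] P.
    split; first by rewrite -defP; apply: partitionD1.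
    apply/forall_inP => y Ey; apply: contra (forall_inP EP y Ey); exact: setU1r.
  split; last by rewrite setU1K ?notin.
  apply/andP; split.
    rewrite -(setD1K Dx); apply: partitionU1 => //.
      by apply/set0Pn; exists x; rewrite set11.
    by rewrite disjoints1 !inE eqxx.
  apply/forall_inP => y Ey; rewrite !inE negb_or (forall_inP EP) // andbT.
  by apply: contra E'x => /eqP/set1_inj <-.
rewrite big_setU1 ?cards1 //=.
by rewrite -defP !inE eqxx.
Qed.

Lemma partition_sumU1 (R : comNzRingType) (t : nat -> R) (T : finType)
    (D E : {set T}) (x : T) :
  x \in D -> x \notin E ->
  partition_sum t D (x |: E)
  = partition_sum t D E - t 1%N * partition_sum t (D :\ x) E.
Proof.
move=> Dx E'x; rewrite -sum_partition_singleton //.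
rewrite /partition_sum [in RHS](bigID (fun P : {set {set T}} => [set x] \in P)) /=.
rewrite addrC; under [X in _ + X - _]eq_bigl do rewrite -andbA.
rewrite addrK; apply: eq_bigl => P.
by rewrite singleton_freeU1 -andbA [([set x] \notin P) && _]andbC.
Qed.

(** With nothing forbidden, only the cardinality of [D] matters: partitions are transported along
    the enumeration [f] of [D], by images one way and preimages the other. *)
Lemma partition_sum0 (R : comNzRingType) (t : nat -> R) (T : finType)
    (D : {set T}) :
  partition_sum t D set0 = bell t #|D|.
Proof.
pose f (i : 'I_#|D|) : T := enum_val i.
have f_inj : injective f := @enum_val_inj _ (mem D).
have f_onto x : x \in D -> exists i, x = f i.
  by move=> Dx; exists (enum_rank_in Dx x); rewrite /f enum_rankK_in.
have defD : D = f @: [set: 'I_#|D|].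
  apply/setP=> x; apply/idP/imsetP=> [/f_onto[i ->] | [i _ ->]]; last exact: enum_valP.
  by exists i.
have fK (B : {set T}) : B \subset D -> f @: (f @^-1: B) = B.
  move=> sBD; apply/setP=> x; apply/imsetP/idP=> [[i] | Bx].
    by rewrite inE => Bi ->.
  have [i def_x] := f_onto x (subsetP sBD x Bx).
  by exists i; rewrite // inE -def_x.
have preK (B : {set 'I_#|D|}) : f @^-1: (f @: B) = B.
  by apply/setP=> i; rewrite inE mem_imset.
rewrite /partition_sum /bell.
rewrite (reindex_onto (fun P : {set {set 'I_#|D|}} => [set f @: B | B : {set _} in P])
                      (fun P : {set {set T}} => [set f @^-1: B | B : {set _} in P])); last first.
  move=> P /andP[partP _]; rewrite -imset_comp -[RHS]imset_id.
  by apply: eq_in_imset => B PB /=; rewrite fK // (partitionS partP).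
apply: eq_big => [P | P _].
  have -> : partition [set f @: B | B : {set _} in P] D = partition P [set: 'I_#|D|].
    by rewrite -[RHS](imset_partition _ _ f_inj) -defD.
  rewrite -imset_comp (eq_imset (g := id)) //.
  rewrite imset_id eqxx andbT.
  have -> : singleton_free set0 [set f @: B | B : {set _} in P].
    by apply/forall_inP=> x; rewrite inE.
  by rewrite andbT.
rewrite big_imset /=; last by move=> B C _ _; apply: imset_inj.
by apply: eq_bigr => B _; rewrite card_imset.
Qed.

(** * The umbral functional *)

Definition umbral {R : comNzRingType} (t : nat -> R) (p : {poly R}) : R :=
  \sum_(i < size p) p`_i * bell t i.

(** A common summation bound makes polynomials of different sizes comparable in the proof of
    linearity. *)
Lemma umbral_widen (R : comNzRingType) (t : nat -> R) (p : {poly R}) n :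
  (size p <= n)%N -> umbral t p = \sum_(i < n) p`_i * bell t i.
Proof.
move=> le_p_n; rewrite /umbral (big_ord_widen _ (fun i => p`_i * bell t i) le_p_n).
rewrite big_mkcond; apply: eq_bigr => i _ /=; case: ltnP => // le_p_i.
by rewrite nth_default ?mul0r.
Qed.

Lemma umbral_is_linear (R : comNzRingType) (t : nat -> R) :
  linear_for *%R (umbral t).
Proof.
move=> a p q; pose n := maxn (size p) (size q).
have le_p : (size p <= n)%N by rewrite leq_maxl.
have le_q : (size q <= n)%N by rewrite leq_maxr.
have le_pq : (size (a *: p + q)%R <= n)%N.
  rewrite (leq_trans (size_polyD _ _)) // geq_max le_q.
  by rewrite (leq_trans (size_scale_leq _ _)).
rewrite (umbral_widen _ le_p) (umbral_widen _ le_q).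
rewrite (umbral_widen _ le_pq) big_distrr -big_split /=.
by apply: eq_bigr => i _; rewrite coefD coefZ mulrDl mulrA.
Qed.

HB.instance Definition _ (R : comNzRingType) (t : nat -> R) :=
  GRing.isLinear.Build R {poly R} R *%R (umbral t) (umbral_is_linear t).

Lemma umbralXn (R : comNzRingType) (t : nat -> R) n : umbral t 'X^n = bell t n.
Proof.
rewrite /umbral size_polyXn big_ord_recr /= coefXn eqxx mul1r big1 ?add0r // => i _.
by rewrite coefXn ltn_eqF ?mul0r.
Qed.

Lemma partition_sum_umbral (R : comNzRingType) (t : nat -> R) (T : finType)
    (D E : {set T}) :
  E \subset D ->
  partition_sum t D E
  = umbral t ('X^(#|D| - #|E|) * ('X - (t 1%N)%:P) ^+ #|E|).
Proof.
(* Induction on the size of [E] with [D] general, since the recursion also shrinks [D]. *)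
elim: {E}_.+1 {-2}E D (ltnSn #|E|) => // n IHn E D ltEn sED.
have [-> | [x Ex]] := set_0Vmem E.
  by rewrite partition_sum0 cards0 subn0 expr0 mulr1 umbralXn.
have Dx := subsetP sED x Ex.
have cardE := cardsD1 x E; rewrite Ex add1n in cardE.
have cardD := cardsD1 x D; rewrite Dx add1n in cardD.
have ltE : (#|E :\ x| < n)%N by rewrite -ltnS -cardE.
have sE'D' : E :\ x \subset D :\ x by apply: setSD.
rewrite -{1}(setD1K Ex) partition_sumU1 //; last by rewrite !inE eqxx.
rewrite !IHn //; last exact: subset_trans (subsetDl _ _) sED.
rewrite -linearZ -linearB /=; congr (umbral t _).
(* With d, e the sizes of [D], [E], the identity is X^(d-e+1) (X-t_1)^(e-1) - t_1 X^(d-e)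
   (X-t_1)^(e-1) = X^(d-e) (X-t_1)^e. The inequality keeps the subtractions from truncating. *)
have := subset_leq_card sE'D'.
rewrite cardE cardD => le_ED; rewrite subSn // subSS exprS exprS -mul_polyC.
ring.
Qed.

(** The condition says that {i} is a block and that no point of the set [E] above i is a singleton.
    Removing {i} gives the factor t_1 and leaves n points, n - k of them in [E]. *)
Lemma bellA_umbral (R : comNzRingType) (t : nat -> R) n k :
  (k <= n)%N ->
  bellA t n k = t 1%N * umbral t ('X^k * ('X - (t 1%N)%:P) ^+ (n - k)).
Proof.
move=> le_kn; pose i : 'I_n.+1 := inord k.
have val_i : i = k :> nat by rewrite inordK.
pose E := [set j : 'I_n.+1 | (i < j)%N].
have E'i : i \notin E by rewrite inE ltnn.
have sED : E \subset [set: 'I_n.+1] :\ i.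
  apply/subsetP=> j; rewrite !inE andbT => ltij.
  by apply: contraTneq ltij => ->; rewrite ltnn.
have cardE : #|E| = (n - k)%N.
  rewrite cardsE -sum1_card.
  rewrite -(big_mkord (fun j => (i < j)%N) (fun _ => 1%N)) val_i.
  rewrite (@big_cat_nat _ _ _ k.+1) //= big_nat_cond big_pred0 ?add0n; last first.
    by move=> j; rewrite ltnS; case: (leqP j k); rewrite ?andbF.
  rewrite big_nat_cond (eq_bigl (fun j => (k < j < n.+1)%N && true)); last first.
    by move=> j; case: (k < j)%N; rewrite ?andbF ?andbT.
  by rewrite -big_nat_cond sum_nat_const_nat muln1 subSS.
rewrite /bellA (eq_bigl (fun P => [&& partition P [set: 'I_n.+1],
    singleton_free E P & [set i] \in P])); last first.
  move=> P; congr (_ && _); apply/existsP/andP.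
    case=> j /and3P[/eqP val_j jP /forallP EP].
    have -> : i = j by apply: val_inj; rewrite /= val_i.
    by split=> //; apply/forall_inP=> l; rewrite inE val_i -val_j; apply/implyP.
  case=> /forall_inP EP iP; exists i; rewrite val_i eqxx iP /=.
  by apply/forallP=> j; apply/implyP; rewrite -val_i => lt_ij; apply: EP; rewrite inE.
rewrite sum_partition_singleton // partition_sum_umbral // cardE.
rewrite [#|_ :\ _|](_ : _ = n) ?subKn //.
by have := cardsD1 i setT; rewrite inE cardsT card_ord add1n => -[].
Qed.

(** * Binomial coefficients in lambda and the polynomial identities *)

Lemma factZ_polybin (a : {poly rat}) k :
  k`!%:R *: polybin a k = \prod_(i < k) (a - i%:R).
Proof. by rewrite /polybin scalerA divff ?scale1r // pnatr_eq0 -lt0n fact_gt0. Qed.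

Lemma fact_scaleI k : injective (fun p : {poly rat} => k`!%:R *: p).
Proof. by apply: scalerI; rewrite pnatr_eq0 -lt0n fact_gt0. Qed.

Lemma polybin0 (a : {poly rat}) : polybin a 0 = 1.
Proof. by apply: (@fact_scaleI 0); rewrite factZ_polybin big_ord0 scale1r. Qed.

(** Once denominators are cleared, all terms share a(a-1)...(a-k+1), and the cofactors satisfy 1 + a
    = (k+1) + (a-k). *)
Lemma polybin_pascal (a : {poly rat}) k :
  polybin (1 + a) k.+1 = polybin a k + polybin a k.+1.
Proof.
apply: (@fact_scaleI k.+1); rewrite scalerDr !factZ_polybin.
rewrite {1}factS natrM -scalerA factZ_polybin -mulr_algl.
rewrite big_ord_recl [in RHS]big_ord_recr /=.
under eq_bigr => i _ do rewrite /bump /= add1n -[i.+1]add1n natrD opprD addrACA subrr add0r.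
rewrite subr0 scaler_nat -[k.+1]addn1 natrD.
ring.
Qed.

(** The falling factorial of length k at a, followed by that of length j at a - k, is the one of
    length k + j at a. *)
Lemma polybin_mul (a : {poly rat}) k j :
  polybin a k * polybin (a - k%:R) j = 'C(k + j, k)%:R * polybin a (k + j).
Proof.
have kfact_neq0 : k`!%:R != 0 :> rat by rewrite pnatr_eq0 -lt0n fact_gt0.
apply: (scalerI kfact_neq0); apply: (@fact_scaleI j).
rewrite /= scalerAl scalerAr !factZ_polybin.
transitivity ((k + j)`!%:R *: polybin a (k + j)).
  rewrite factZ_polybin big_split_ord /=; congr (_ * _).
  by apply: eq_bigr => i _; rewrite natrD opprD addrA.
rewrite -(bin_fact (leq_addr j k)) addKn mulr_natl -scaler_nat !scalerA -!natrM.
by rewrite mulnC [(j`! * _)%N]mulnC.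
Qed.

(** The preimage under the umbral functional of the common left-hand side, without the factors t_1
    and x^m. The morphism [phi] carries the coefficients in lambda into the ring of x and t. *)
Definition shifted_sum (S : comNzRingType) (phi : {rmorphism {poly rat} -> S})
    (l : {poly rat}) (x t : S) (n : nat) : S :=
  \sum_(k < n.+1) phi (polybin (k%:R + l - 1) k) * (x ^+ k * (x - t) ^+ (n - k)).

Lemma shifted_sum_rec (S : comNzRingType) (phi : {rmorphism {poly rat} -> S})
    (l : {poly rat}) (x t : S) n :
  shifted_sum phi l x t n.+1
  = (x - t) * shifted_sum phi l x t n + phi (polybin (n%:R + l) n.+1) * x ^+ n.+1.
Proof.
rewrite /shifted_sum big_ord_recr /= subnn mulr1; congr (_ + _); last first.
  by rewrite -[n.+1]addn1 natrD addrAC addrK.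
rewrite big_distrr; apply: eq_bigr => k _ /=.
by rewrite subSn -1?ltnS // exprS; ring.
Qed.

Lemma shifted_sum_alternating (S : comNzRingType) (phi : {rmorphism {poly rat} -> S})
    (l : {poly rat}) (x t : S) n :
  shifted_sum phi l x t n
  = \sum_(k < n.+1)
    phi ((-1) ^+ (n - k) * polybin (n%:R + l) k) * (x ^+ k * t ^+ (n - k)).
Proof.
(* The signs are absorbed into powers of [- t]. *)
under eq_bigr => k _ do
  rewrite rmorphM rmorphXn rmorphN1 [_ * phi _]mulrC mulrCA -!mulrA -exprNn mulrCA.
elim: n => [|n IHn].
  by rewrite /shifted_sum !big_ord1 !polybin0.
rewrite shifted_sum_rec IHn.
have natlS : n.+1%:R + l = 1 + (n%:R + l) by rewrite -add1n natrD addrA.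
rewrite natlS [in RHS]big_ord_recl /= polybin0.
under [in RHS]eq_bigr => k _ do rewrite /bump /= add1n polybin_pascal rmorphD mulrDl.
(* By Pascal's rule, the part with [polybin (n%:R + l) k] is x times the sum for n. *)
rewrite big_split /= addrCA mulrBl -addrA; congr (_ + _).
  by rewrite big_distrr; apply: eq_bigr => k _ /=; rewrite subSS exprS; ring.
(* The middle sum is the rest of Pascal's rule with its k = 0 term restored. Splitting off its last
   term instead leaves -t times the sum for n. *)
transitivity (\sum_(k < n.+2) phi (polybin (n%:R + l) k) * (x ^+ k * (- t) ^+ (n.+1 - k))).
  rewrite [in RHS]big_ord_recr /= subnn expr0 mulr1 -mulNr; congr (_ + _).
  rewrite big_distrr; apply: eq_bigr => k _ /=.
  by rewrite subSn -1?ltnS // exprS; ring.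
by rewrite big_ord_recl /= polybin0.
Qed.

Lemma shifted_sum_binomial (S : comNzRingType) (phi : {rmorphism {poly rat} -> S})
    (l : {poly rat}) (x t : S) n :
  shifted_sum phi l x t n
  = \sum_(k < n.+1)
    phi (polybin (n%:R + l) k * polybin (n%:R + l - k%:R - 1) (n - k))
      * ((x - t) ^+ k * t ^+ (n - k)).
Proof.
elim: n => [|n IHn].
  by rewrite /shifted_sum !big_ord1 !polybin0 mulr1.
rewrite shifted_sum_rec IHn [in RHS]big_ord_recl /= polybin0 subn0 mul1r.
have natlS : n.+1%:R + l = 1 + (n%:R + l) by rewrite -add1n natrD addrA.
have shift (k : nat) : n.+1%:R + l - k%:R - 1 = n%:R + l - k%:R.
  by rewrite -[n.+1]addn1 natrD; ring.
rewrite shift subr0.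
under [in RHS]eq_bigr => k _.
  rewrite shift /bump /= add1n subSS natlS polybin_pascal.
  rewrite mulrDl rmorphD mulrDl.
  (* In the second half of Pascal's rule the two factors merge, leaving only an ordinary binomial
     coefficient depending on k. *)
  rewrite [polybin _ k.+1 * _](_ : _ = 'C(n.+1, k.+1)%:R * polybin (n%:R + l) n.+1); last first.
    have def_n : (k.+1 + (n - k))%N = n.+1 by rewrite addSn subnKC // -ltnS.
    by have := polybin_mul (n%:R + l) k.+1 (n - k); rewrite def_n.
  over.
(* The first half of Pascal's rule is (x - t) times the sum for n. *)
rewrite big_split /= addrCA; congr (_ + _).
  rewrite big_distrr; apply: eq_bigr => k _ /=.
  by rewrite -[k.+1]addn1 natrD opprD addrA exprD; ring.
(* The other terms, with the k = 0 term included, form the binomial expansion of (t + (x -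
   t))^(n+1), which is the x^(n+1) of the recurrence. *)
have {1}-> : x = t + (x - t) by ring.
rewrite exprDn big_ord_recl mulrDr big_distrr /=; congr (_ + _).
  by rewrite !subn0 bin0; ring.
apply: eq_bigr => k _; rewrite /bump /= add1n subSS rmorphM rmorph_nat -mulr_natl; ring.
Qed.

(** * Transfer to the partition sums *)

Definition tpolyC : {rmorphism {poly rat} -> {poly tring}} :=
  polyC \o GRing.in_alg tring.

Lemma umbral_scale (t : nat -> tring) (c : {poly rat}) (p : {poly tring}) :
  umbral t (tpolyC c * p) = c *: umbral t p.
Proof. by rewrite /= mul_polyC linearZ /= mulr_algl. Qed.

Lemma umbral_mulC (t : nat -> tring) (a : tring) (p : {poly tring}) :
  umbral t (p * a%:P) = umbral t p * a.
Proof. by rewrite mulrC mul_polyC linearZ /= mulrC. Qed.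

Lemma sum_bellA_umbral n m :
  \sum_(0 <= k < n.+1)
    polybin (k%:R + lambda - 1) k *: bellA tvar (n + m) (m + k)
  = tvar 1%N * umbral tvar
      ('X^m * shifted_sum tpolyC lambda 'X (tvar 1%N)%:P n).
Proof.
rewrite big_mkord ['X^m * _]mulr_sumr linear_sum mulr_sumr /=; apply: eq_bigr => k _.
rewrite bellA_umbral; last by rewrite addnC leq_add2r -ltnS.
rewrite [(n + m)%N]addnC subnDl mulrCA umbral_scale scalerAr exprD.
by rewrite mulrA.
Qed.

Theorem theorem2p2 (n m : nat) :
  (\sum_(0 <= k < n.+1)
      polybin (k%:R + lambda - 1) k *: bellA tvar (n + m) (m + k)
   = \sum_(0 <= k < n.+1)
      (polybin (n%:R + lambda) k * polybin (n%:R + lambda - k%:R - 1) (n - k))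
        *: (bellA tvar (m + k) m * tvar 1%N ^+ (n - k)))
  /\
  (\sum_(0 <= k < n.+1)
      polybin (k%:R + lambda - 1) k *: bellA tvar (n + m) (m + k)
   = \sum_(0 <= k < n.+1)
      ((-1) ^+ (n - k) * polybin (n%:R + lambda) k)
        *: (bell tvar (m + k) * tvar 1%N ^+ (n - k).+1)).
Proof.
split; apply: (etrans (sum_bellA_umbral n m)); rewrite [RHS]big_mkord.
  rewrite shifted_sum_binomial ['X^m * _]mulr_sumr linear_sum mulr_sumr /=.
  apply: eq_bigr => k _.
  (* Here [bellA tvar (m + k) m] is t_1 L(x^m (x - t_1)^k), since (m + k) - m = k. *)
  rewrite bellA_umbral ?leq_addr // addKn mulrCA umbral_scale scalerAr -rmorphXn.
  by rewrite mulrA umbral_mulC scalerAr mulrA.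
rewrite shifted_sum_alternating ['X^m * _]mulr_sumr linear_sum mulr_sumr /=.
apply: eq_bigr => k _.
(* The monomial x^(m+k) yields Y_(m+k); the prefactor t_1 raises the exponent n - k by one. *)
rewrite mulrCA umbral_scale -rmorphXn mulrA -exprD umbral_mulC umbralXn.
by rewrite -scalerAr mulrCA exprS.
Qed.
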